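(* Let $G$ be a finite directed multigraph with vertex set $\{1,\ldots,n\}$ and adjacency matrix $M=(m_{ij})$, where $m_{ij}$ is the number of edges from $i$ to $j$ (loops allowed). Let $\mathbf{q}$ and $\mathbf{s}$ be vectors of nonnegative integers indexed by $V(G)$ (quota and start portfolio), and put $\mathbf{in}=\mathbf{q}M$. Let $F_{\mathrm{used}}\subset F_{\mathrm{seen}}$ be the forests of used and of seen edges at some stage of a quota search in $G$ with exact start portfolio $\mathbf{s}$. For $v\in V(G)$ let $\mathbf{seen}(v)$ and $\mathbf{used}(v)$ be the number of edges ending at (a lift of) $v$ in $F_{\mathrm{seen}}$ and in $F_{\mathrm{used}}$ respectively. Then the number of quota forests over $G$ with start portfolio exactly $\mathbf{s}$ which achieve quotas $\mathbf{q}$, extend $F_{\mathrm{used}}$, and contain no edges from $F_{\mathrm{seen}}\setminus F_{\mathrm{used}}$ equals the quota symbol $$\left\{\begin{array}{c}\mathbf{in}-\mathbf{seen}\\ \mathbf{q}-\mathbf{s}-\mathbf{used}\end{array}\right\}_G .$$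
   Context: Quota symbol: for vectors $\mathbf{a}=(a_i)$, $\mathbf{b}=(b_i)$ of length $n$, $$\left\{\begin{array}{c}\mathbf{a}\\ \mathbf{b}\end{array}\right\}_G:=\det M(\mathbf{a},\mathbf{b})\prod_i\binom{a_i}{b_i}(a_i)^{-1},\qquad M(\mathbf{a},\mathbf{b})=\mathrm{diag}(\mathbf{a})-M\,\mathrm{diag}(\mathbf{b}),$$ where the binomial coefficient $\binom{m}{k}$ is zero unless $0\le k\le m$, and for any index $i$ with $a_i=0$ the factor $a_i^{-1}$ is omitted and the corresponding row and column of $M(\mathbf{a},\mathbf{b})$ are deleted (the determinant of the empty matrix is $1$). Universal out-cover: for $v\in V(G)$, $(\tilde G_v,\tilde v)$ is the rooted directed tree whose vertices are the finite directed paths in $G$ starting at $v$ (including the empty path $\tilde v$, its root), with an edge from each path $p$ to each one-edge extension $pe$; the map to $G$ sends a path to its endpoint and the edge $p\to pe$ to $e$. Let $U$ be the disjoint union of copies $\tilde G_{v,k}$ of $\tilde G_v$ for $v\in V(G)$, $1\le k\le s_v$. A quota tree over $G$ with root $v$ (a finite rooted out-directed tree mapping to $G$, root to $v$, injectively on the outgoing edges of each vertex, up to isomorphism over $G$) is the same as a finite subtree of $\tilde G_v$ containing $\tilde v$. Accordingly, a quota forest over $G$ with start portfolio exactly $\mathbf{s}$ is a finite subgraph $F$ of $U$ whose intersection with each $\tilde G_{v,k}$ is a subtree containing the root; it achieves quotas $\mathbf{q}$ if for each $w\in V(G)$ exactly $q_w$ vertices of $F$ map to $w$. Stages of a quota search: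 initially $F_{\mathrm{used}}=F_{\mathrm{seen}}$ consists of the roots of all the $\tilde G_{v,k}$ (and no edges). The queue contains the edges of $U$ whose initial vertex lies in $F_{\mathrm{used}}$ and which have not yet been dequeued. At each step one edge of the queue is dequeued and added (with its terminal vertex) to $F_{\mathrm{seen}}$, and it is then either used, i.e. also added to $F_{\mathrm{used}}$ (whereupon the edges of $U$ leaving its terminal vertex join the queue), or skipped. Thus $F_{\mathrm{used}}$ is a quota forest with start portfolio $\mathbf{s}$, and $F_{\mathrm{seen}}$ is obtained from it by adding the skipped edges, each of which has its initial vertex in $F_{\mathrm{used}}$. Roots do not count as edges in $\mathbf{seen}$ and $\mathbf{used}$. A quota forest $F$ extends $F_{\mathrm{used}}$ if $F_{\mathrm{used}}\subset F$ as subgraphs of $U$. *)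

(* Defs.v *)
From mathcomp Require Import all_boot all_order all_algebra.
From mathcomp Require Import finmap.

Set Implicit Arguments.
Unset Strict Implicit.
Unset Printing Implicit Defensive.

Import Order.TTheory GRing.Theory Num.Theory.

Local Open Scope ring_scope.
Local Open Scope fset_scope.

Record multidigraph (n : nat) := Multidigraph {
  edge : finType;
  src : edge -> 'I_n;
  tgt : edge -> 'I_n }.

Definition adjmx n (G : multidigraph n) : 'M[nat]_n :=
  \matrix_(i, j) #|[set e : edge G | (src e == i) && (tgt e == j)]|.

Definition binz (m k : int) : nat :=
  if (0 <= k) && (k <= m) then 'C(`|m|%N, `|k|%N) else 0%N.

Definition quota_mx n (M : 'M[nat]_n) (a b : 'rV[int]_n) : 'M[int]_n :=
  diag_mx a - map_mx Posz M *m diag_mx b.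

(* The rows and columns kept in the determinant are those i with a_i <> 0;
   the determinant of a 0 x 0 matrix is 1. *)
Definition quota_symbol n (M : 'M[nat]_n) (a b : 'rV[int]_n) : rat :=
  let keep := @enum_val _ [pred i : 'I_n | a 0 i != 0] in
  (\det (mxsub keep keep (quota_mx M a b)))%:~R *
  \prod_(i < n) ((binz (a 0 i) (b 0 i))%:R *
                 (if a 0 i == 0 then 1 else (a 0 i)%:~R^-1)).

Section UniversalOutCover.
Variables (n : nat) (G : multidigraph n).

Fixpoint is_dipath (v : 'I_n) (p : seq (edge G)) : bool :=
  if p is e :: p' then (src e == v) && is_dipath (tgt e) p' else true.

Definition endpoint (v : 'I_n) (p : seq (edge G)) : 'I_n :=
  last v [seq tgt e | e <- p].

Lemma is_dipath_rcons v p e :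
  is_dipath v (rcons p e) = is_dipath v p && (src e == endpoint v p).
Proof.
elim: p v => [|e' p IHp] v /=; first by rewrite andbT.
by rewrite IHp andbA.
Qed.

Definition dipath (v : 'I_n) := {p : seq (edge G) | is_dipath v p}.

Definition dipath0 (v : 'I_n) : dipath v := exist (is_dipath v) [::] isT.

Variable s : 'rV[nat]_n.

Definition copy := {v : 'I_n & 'I_(s 0 v)}.

(* A vertex of U is a copy index (v, k) together with a directed path of G
   starting at v. *)
Definition uvertex := {c : copy & dipath (tag c)}.

Definition uroot (c : copy) : uvertex :=
  Tagged (fun c : copy => dipath (tag c)) (dipath0 (tag c)).

Definition uproj (x : uvertex) : 'I_n :=
  endpoint (tag (tag x)) (val (tagged x)).

(* The edge p -> pe of U is encoded as the pair (p, e). *)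
Definition uedge := {d : uvertex * edge G | src d.2 == uproj d.1}.

Definition uinit (d : uedge) : uvertex := (val d).1.

Lemma uterm_subproof (d : uedge) :
  is_dipath (tag (tag (uinit d))) (rcons (val (tagged (uinit d))) (val d).2).
Proof. by rewrite is_dipath_rcons (valP (tagged (uinit d))) (valP d). Qed.

Definition uterm (d : uedge) : uvertex :=
  Tagged (fun c : copy => dipath (tag c))
    (exist (is_dipath (tag (tag (uinit d)))) _ (uterm_subproof d)).

(* A finite set of vertices and a finite set of edges of U; it is a subgraph
   when is_subgraph holds. *)
Definition usub := ({fset uvertex} * {fset uedge})%type.

Implicit Types F H : usub.

Definition is_subgraph F : Prop :=
  forall d, d \in F.2 -> uinit d \in F.1 /\ uterm d \in F.1.

Definition in_copy F (c : copy) : usub :=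
  ([fset x in F.1 | tag x == c], [fset d in F.2 | tag (uinit d) == c]).

Definition adjacent H : rel uvertex := fun x y =>
  has (fun d => ((uinit d == x) && (uterm d == y))
             || ((uinit d == y) && (uterm d == x))) H.2.

Definition connected H : Prop :=
  forall x y, x \in H.1 -> y \in H.1 ->
  exists p, path (adjacent H) x p /\ last x p = y.

(* Each copy is a tree, so its subtrees are its nonempty connected
   subgraphs. *)
Definition quota_forest F : Prop :=
  is_subgraph F /\
  forall c : copy, uroot c \in (in_copy F c).1 /\ connected (in_copy F c).

Definition achieves F (q : 'rV[nat]_n) : Prop :=
  forall w : 'I_n, #|` [fset x in F.1 | uproj x == w]| = q 0 w.

Definition extends F0 F : Prop := F0.1 `<=` F.1 /\ F0.2 `<=` F.2.

Definition uroots : usub := ([fset uroot c | c in [set: copy]], fset0).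

Definition add_edge F (d : uedge) : usub := (uterm d |` F.1, d |` F.2).

(* The dequeued edges are exactly those of F_seen. *)
Definition queued (used seen : usub) (d : uedge) : Prop :=
  uinit d \in used.1 /\ d \notin seen.2.

Inductive search_stage : usub -> usub -> Prop :=
| stage_init : search_stage uroots uroots
| stage_use used seen d :
    search_stage used seen -> queued used seen d ->
    search_stage (add_edge used d) (add_edge seen d)
| stage_skip used seen d :
    search_stage used seen -> queued used seen d ->
    search_stage used (add_edge seen d).

Definition edge_count F : 'rV[nat]_n :=
  \row_v #|` [fset d in F.2 | uproj (uterm d) == v]|.

End UniversalOutCover.

(* Main.v *)
Require Import Defs.
From mathcomp Require Import all_boot all_order all_algebra.
From mathcomp Require Import finmap.
From mathcomp Require Import ring zify.

Set Implicit Arguments.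
Unset Strict Implicit.
Unset Printing Implicit Defensive.

Import Order.TTheory GRing.Theory Num.Theory.

Local Open Scope ring_scope.

(** Write M for the adjacency matrix, [a = in - seen] for the supply and
    [b = q - s - used] for the demand; a completion of the stage is a quota
    forest counted by the theorem.  The proof runs the search to its end and
    checks that both sides obey the same recurrence and the same boundary
    values.

    Dequeue an edge d ending above v.  A completion either contains d or does
    not, so the completions of the current stage are split between the stages
    in which d is used and in which d is skipped ([completion_queued],
    [completion_disjoint]).  Using d replaces (a, b) by (a - e_v, b - e_v) and
    skipping it replaces (a, b) by (a - e_v, b), so the quota symbol should
    satisfy Pascal's rule in direction v.  The key to this is
    [quota_symbolE]: with x_i = b_i / a_i (and x_i = 0 when a_i = 0), the symbol
    equals det (1 - diag(x) M) times the product of the binomials.  The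
    determinant is affine in x_v, and multiplying C(a_v, b_v) by x_v gives
    C(a_v - 1, b_v - 1), so Pascal's rule for the symbol is Pascal's rule for
    these two binomials.  The second one fails when a_v = b_v = 1, and there
    the coefficient of x_v has to vanish.

    It does because supply and demand are linked: counting the edges that
    leave the used vertices gives a = b M + c, where c_v is the number of
    queued edges ending above v ([supplyE]).  If d is in the queue and a_v = 1
    then c_v = 1 and (b M)_v = 0, which makes a column of the relevant matrix
    zero ([quota_symbol_pascal]).

    The recursion ends in two ways.  If 0 <= b <= a fails, a binomial is 0, and
    no completion exists, by counting its edges ([completion_bounds]).
    Otherwise, if the queue is empty then a = b M, so a (1 - diag(x) M) = 0 and
    the symbol vanishes unless b = 0, where it is 1 ([quota_symbol_closed]); and
    the only possible completion is the used forest itself, which meets the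
    quotas exactly when b = 0 ([completion_closed]). *)

(** * Determinants and quota symbols *)

(** Multiplying the block matrix with rows (1, A) and (B, 1) on either side by
    the unitriangular one with rows (1, 0) and (-B, 1) makes it block
    triangular, with one of the two determinants as its value.  A and B may be
    rectangular; this is what absorbs the deletion of rows and columns below. *)
Lemma det_1B_mulmxC (R : comNzRingType) m n (A : 'M[R]_(m, n)) (B : 'M_(n, m)) :
  \det (1%:M - A *m B) = \det (1%:M - B *m A).
Proof.
have E1 : block_mx 1%:M A B 1%:M *m block_mx 1%:M 0 (- B) 1%:M
          = block_mx (1%:M - A *m B) A 0 1%:M.
  rewrite mulmx_block !mul1mx !mulmx1 !mulmx0 ?add0r ?addr0 mulmxN subrr.
  by [].
have E2 : block_mx 1%:M 0 (- B) 1%:M *m block_mx 1%:M A B 1%:M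
          = block_mx 1%:M A 0 (1%:M - B *m A).
  rewrite mulmx_block !mul1mx !mulmx1 !mul0mx ?add0r ?addr0 mulNmx.
  by rewrite addNr addrC.
have := congr1 determinant E1; have := congr1 determinant E2.
by rewrite !det_mulmx !det_ublock !det_lblock !det1 !mul1r !mulr1 => <- <-.
Qed.

Section QuotaSymbol.
Variable n : nat.
Implicit Types (M : 'M[nat]_n) (a b : 'rV[int]_n) (x y : 'rV[rat]_n) (v : 'I_n).

Definition ratmx M : 'M[rat]_n := map_mx (fun k => k%:R) M.

(** As [x / 0 = 0], an index i with a_i = 0 gets ratio 0, which turns row i of
    1 - diag(ratio) M into a row of the identity. *)
Definition ratio a b : 'rV[rat]_n := \row_i ((b 0 i)%:~R / (a 0 i)%:~R).

(** Dividing the kept columns by the a_j turns the deleted-index determinant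
    into that of 1 - A B, where A keeps some rows of M and B some columns of
    diag(ratio).  Swapping A and B restores the full size: the sum over kept
    indices loses nothing, as the ratios at the deleted ones are 0. *)
Lemma quota_symbolE M a b :
  quota_symbol M a b =
    \det (1%:M - diag_mx (ratio a b) *m ratmx M) *
    \prod_i (binz (a 0 i) (b 0 i))%:R.
Proof.
rewrite /quota_symbol; set P := [pred i : 'I_n | _].
set keep := @enum_val _ P.
rewrite big_split /= [RHS]mulrC mulrCA; congr (_ * _).
rewrite (bigID (fun i => i \in P)) /= [X in _ * (_ * X)]big1 ?mulr1; last first.
  by move=> i; rewrite inE negbK => ->.
rewrite (eq_bigr (fun i => ((a 0 i)%:~R : rat)^-1)); last first.
  by move=> i; rewrite inE => /negbTE ->.
have -> : \prod_(i in P) ((a 0 i)%:~R : rat)^-1 =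
    \det (diag_mx (\row_k ((a 0 (keep k))%:~R : rat)^-1)).
  rewrite det_diag (big_enum_val (fun i => ((a 0 i)%:~R : rat)^-1)) /=.
  by apply: eq_bigr => k _; rewrite mxE.
rewrite -det_map_mx -det_mulmx.
have keepP k : (a 0 (keep k))%:~R != 0 :> rat.
  by rewrite intr_eq0; have := enum_valP k; rewrite inE.
transitivity (\det (1%:M - rowsub keep (ratmx M)
                    *m colsub keep (diag_mx (ratio a b)))).
  congr (\det _); apply/matrixP => i j.
  rewrite -mxsub_mul /quota_mx !mul_mx_diag !mxE (inj_eq enum_val_inj).
  rewrite rmorphB /= rmorphM rmorphMn /= mulrBl.
  rewrite mulrA; congr (_ - _); case: eqP => [->|_]; last by rewrite mul0r.
  by rewrite mulr1n; apply: divff; apply: keepP.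
rewrite det_1B_mulmxC; congr (\det (_ - _)); apply/matrixP => i j.
rewrite mul_diag_mx [LHS]mxE [RHS]mxE.
transitivity (\sum_(l in P) (ratio a b 0 i *+ (i == l)) * ratmx M l j).
  by rewrite [RHS]big_enum_val; apply: eq_bigr => k _; rewrite !mxE.
have [iP|] := boolP (i \in P).
  rewrite (bigD1 i) //= big1 ?addr0 => [|k /andP[_]].
    by rewrite eqxx !mxE.
  by rewrite eq_sym => /negbTE->; rewrite mulr0n mul0r.
rewrite inE negbK => /eqP ai0.
have -> : ratio a b 0 i = 0 by rewrite mxE ai0 invr0 mulr0.
by rewrite mul0r big1 // => k _; rewrite mul0rn mul0r.
Qed.

(** The rule fails only at the apex of Pascal's triangle. *)
Lemma binz_pascal (m k : int) : (m, k) != (0, 0) ->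
  binz m k = (binz (m - 1) k + binz (m - 1) (k - 1))%N.
Proof.
have S1 j : j.+1%:Z - 1 = j by lia.
case: m => [[|m]|m]; last by rewrite /binz !ifN //; lia.
  by case: k => [[|k]|k]; rewrite ?S1 /binz //=; lia.
move=> _; rewrite S1.
case: k => [[|k]|k]; rewrite ?S1 /binz /=; first by rewrite !bin0.
  rewrite !lez_nat ltnS binS.
  by case: ltngtP => // ->; rewrite bin_small.
by [].
Qed.

Lemma binz_absorb (m k : int) :
  k%:~R / m%:~R * (binz m k)%:R = (binz (m - 1) (k - 1))%:R :> rat.
Proof.
have S1 j : j.+1%:Z - 1 = j by lia.
case: m => [[|m]|m].
- by rewrite invr0 mulr0 mul0r /binz ifN //; lia.
- rewrite S1; case: k => [[|k]|k]; rewrite ?S1 /binz /= ?mul0r ?mulr0 //.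
  rewrite !lez_nat ltnS; case: ifP => _; rewrite ?mulr0 //.
  rewrite -!pmulrn mulrAC -natrM -mul_bin_diag natrM mulrAC divff ?mul1r //.
  by rewrite pnatr_eq0.
- by rewrite /binz !ifN ?mulr0 //; lia.
Qed.

Definition set_row v (A : 'M[rat]_n) (r : 'rV[rat]_n) : 'M[rat]_n :=
  \matrix_(i, j) if i == v then r 0 j else A i j.

(** Only row v involves x_v, and it is e_v - x_v M_v. *)
Lemma det_affine_row M x v (A := 1%:M - diag_mx x *m ratmx M) :
  \det A = \det (set_row v A (delta_mx 0 v))
           - x 0 v * \det (set_row v A (row v (ratmx M))).
Proof.
rewrite -mulNr -[\det (set_row v A (delta_mx 0 v))]mul1r.
apply: (determinant_multilinear (i0 := v)).
- apply/rowP => j; rewrite /A mul_diag_mx !mxE !eqxx mul1r mulNr.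
  by rewrite [v == j]eq_sym.
- by apply/matrixP => i j; rewrite !mxE eq_sym (negPf (neq_lift _ _)).
- by apply/matrixP => i j; rewrite !mxE eq_sym (negPf (neq_lift _ _)).
Qed.

Lemma eq_set_row M v x y r :
  (forall i, i != v -> x 0 i = y 0 i) ->
  set_row v (1%:M - diag_mx x *m ratmx M) r
  = set_row v (1%:M - diag_mx y *m ratmx M) r.
Proof.
move=> xy; apply/matrixP => i j; rewrite !mul_diag_mx !mxE.
by case: eqVneq => // /xy->.
Qed.

Lemma row_sub_delta a v i : (a - delta_mx 0 v) 0 i = a 0 i - (i == v)%:R.
Proof. by rewrite !mxE. Qed.

(** Isolating x_v writes each of the three symbols as a common factor times
    C(a_v, b_v) D0 - x_v C(a_v, b_v) D1, with the same D0 and D1.  The D0 parts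
    match by Pascal's rule; so do the D1 parts after absorption, except when
    a_v = b_v = 1, where they read 1 = 0 + 0.  The second hypothesis makes D1
    vanish in that case. *)
Lemma quota_symbol_pascal M a b v : a 0 v != 0 ->
    (a 0 v = 1 -> b 0 v = 1 -> forall i, b 0 i * (M i v)%:Z = 0) ->
  quota_symbol M a b = quota_symbol M (a - delta_mx 0 v) b
    + quota_symbol M (a - delta_mx 0 v) (b - delta_mx 0 v).
Proof.
move=> av0 av1.
pose A := 1%:M - diag_mx (ratio a b) *m ratmx M.
pose D0 := \det (set_row v A (delta_mx 0 v)).
pose D1 := \det (set_row v A (row v (ratmx M))).
pose P : rat := \prod_(i | i != v) (binz (a 0 i) (b 0 i))%:R.
have E a' b' : (forall i, i != v -> a' 0 i = a 0 i) ->
    (forall i, i != v -> b' 0 i = b 0 i) ->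
    quota_symbol M a' b' = P * ((binz (a' 0 v) (b' 0 v))%:R * D0
      - (b' 0 v)%:~R / (a' 0 v)%:~R * (binz (a' 0 v) (b' 0 v))%:R * D1).
  move=> Ea Eb; rewrite quota_symbolE (bigD1 v) //=.
  rewrite (eq_bigr (fun i => (binz (a 0 i) (b 0 i))%:R)) => [|i iv]; last first.
    by rewrite Ea ?Eb.
  have Er i : i != v -> ratio a' b' 0 i = ratio a b 0 i.
    by move=> iv; rewrite !mxE Ea ?Eb.
  rewrite (det_affine_row _ _ v) !(eq_set_row _ _ Er) -/P -/A -/D0 -/D1.
  rewrite [ratio _ _ _ _]mxE; ring.
have off c i : i != v -> (c - delta_mx 0 v : 'rV[int]_n) 0 i = c 0 i.
  by move=> /negPf iv; rewrite row_sub_delta iv subr0.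
rewrite !E //; try exact: off.
rewrite !row_sub_delta eqxx -mulrDr; congr (_ * _).
rewrite !binz_absorb; rewrite binz_pascal ?xpair_eqE ?(negPf av0) // natrD.
have [/eqP|] := eqVneq (a 0 v - 1, b 0 v - 1) (0, 0); last first.
  by move=> /binz_pascal->; rewrite natrD; ring.
rewrite xpair_eqE !subr_eq0 => /andP[/eqP av /eqP bv].
(* Column v of the matrix of D1 is zero: its entry in row v is M v v, and in
   row i it is - x_i M i v. *)
suff -> : D1 = 0 by ring.
rewrite /D1 (expand_det_col _ v) big1 // => i _.
rewrite /A mul_diag_mx !mxE.
have : b 0 i * (M i v)%:Z = 0 by apply: av1.
have [-> /eqP|iv /eqP] := eqVneq i v.
  by rewrite bv mul1r => /eqP [->]; rewrite mul0r.
rewrite mulf_eq0 => /orP[/eqP->|/eqP[->]].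
  by rewrite mul0r mul0r subrr mul0r.
by rewrite mulr0 subrr mul0r.
Qed.

Lemma quota_symbol_out M a b v :
  ~~ (0 <= b 0 v <= a 0 v) -> quota_symbol M a b = 0.
Proof.
move=> /negPf out; rewrite quota_symbolE (bigD1 v) //= /binz out.
by rewrite mul0r mulr0.
Qed.

(** The row vector a is a left null vector: a diag(x) = b, including at the
    indices with a_i = 0 once 0 <= b <= a, so a (1 - diag(x) M) = a - b M = 0.  If
    b is nonzero then so is a. *)
Lemma quota_symbol_closed M a b :
  a = b *m map_mx Posz M -> quota_symbol M a b = (b == 0)%:R.
Proof.
move=> aE; have [b0|bn0] := eqVneq b 0.
  have a0 : a = 0 by rewrite aE b0 mul0mx.
  rewrite quota_symbolE a0 b0 big1 => [|i _]; last by rewrite mxE.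
  have -> : ratio 0 0 = 0 by apply/rowP => i; rewrite !mxE mul0r.
  by rewrite raddf0 mul0mx subr0 det1 mulr1.
have [/forallP rng|/forallPn[v]] := boolP [forall v, 0 <= b 0 v <= a 0 v];
  last exact: quota_symbol_out.
rewrite quota_symbolE; set A := _ - _.
suff /eqP-> : \det A == 0 by rewrite mul0r.
have a0b0 i : a 0 i = 0 -> b 0 i = 0 by have := rng i; lia.
apply/det0P; exists (map_mx intr a).
  apply: contraNneq bn0 => a0; apply/eqP/rowP => i; rewrite mxE; apply: a0b0.
  by move/rowP/(_ i): a0; rewrite !mxE => /eqP; rewrite intr_eq0 => /eqP.
rewrite mulmxBr mulmx1 mulmxA mul_mx_diag; apply/eqP; rewrite subr_eq0.
apply/eqP/rowP => j; rewrite mxE [in LHS]aE [in LHS]mxE rmorph_sum [RHS]mxE.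
apply: eq_bigr => i _; rewrite !mxE rmorphM /= -pmulrn; congr (_ * _).
have [ai0|ain0] := eqVneq (a 0 i) 0; first by rewrite a0b0 // ai0 mul0r.
by rewrite mulrCA divff ?mulr1 // intr_eq0.
Qed.

End QuotaSymbol.

(** * Trees and edges of the universal out-cover *)

Local Open Scope fset_scope.
Local Open Scope ring_scope.

Lemma path_crossing (T : Type) (r : rel T) (D : pred T) x p :
    path r x p -> ~~ D x -> D (last x p) ->
  exists y z, [/\ r y z, ~~ D y & D z].
Proof.
elim: p x => [|y p IHp] x /=; first by move=> _ /negPf->.
case/andP=> rxy pth Dx; have [Dy _|] := boolP (D y); last exact: IHp.
by exists x, y.
Qed.

Lemma path_rev_sym (T : Type) (r : rel T) x p : symmetric r ->
  path r x p -> path r (last x p) (rev (belast x p)).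
Proof. by move=> rC; rewrite rev_path (eq_path (e' := r)) // => y z. Qed.

Section Cover.
Variables (n : nat) (G : multidigraph n) (s : 'rV[nat]_n).
Implicit Types (x y z : uvertex G s) (d : uedge G s) (F H : usub G s).
Implicit Types (v w : 'I_n) (c : copy s).

Definition walk x : seq (edge G) := val (tagged x).

Lemma walk_inj x y : tag x = tag y -> walk x = walk y -> x = y.
Proof.
case: x y => [c [p hp]] [c' [p' hp']] /= ecc'; case: c' / ecc' hp' => hp' epp'.
by congr Tagged; apply: val_inj.
Qed.

Lemma walk_eq0 x : walk x = [::] -> x = uroot G (tag x).
Proof. by move=> wx; apply: walk_inj. Qed.

Lemma walk_uroot c : walk (uroot G c) = [::].
Proof. by []. Qed.

Lemma walk_uterm d : walk (uterm d) = rcons (walk (uinit d)) (val d).2.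
Proof. by []. Qed.

Lemma uproj_uterm d : uproj (uterm d) = tgt (val d).2.
Proof. by rewrite /uproj /endpoint /= map_rcons last_rcons. Qed.

Lemma uterm_inj : injective (@uterm n G s).
Proof.
move=> d d' edd'; have etag : tag (uinit d) = tag (uinit d') := congr1 tag edd'.
have /rcons_inj[ewalk ee] : walk (uterm d) = walk (uterm d') by rewrite edd'.
apply: val_inj; rewrite [val d]surjective_pairing [val d']surjective_pairing ee.
by congr pair; apply: walk_inj.
Qed.

Lemma uroot_neq_uterm c d : uroot G c <> uterm d.
Proof.
by move=> /(congr1 walk)/(congr1 size); rewrite walk_uterm size_rcons.
Qed.

Lemma uroot_inj : injective (@uroot n G s).
Proof. by move=> c c' /(congr1 tag). Qed.

Lemma mem_uroots c : uroot G c \in (uroots G s).1.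
Proof. by apply/imfsetP; exists c; rewrite ?inE. Qed.

(** The description of quota forests that counting uses: every vertex is a root
    or the end of an edge of F.  Its equivalence with connectedness is
    [quota_forest_grounded] and [grounded_quota_forest]. *)
Definition grounded F :=
  is_subgraph F /\ F.1 = (uroots G s).1 `|` (@uterm n G s @` F.2).

Lemma groundedP F : grounded F -> forall x,
  x \in F.1 -> x = uroot G (tag x) \/ exists2 d, d \in F.2 & x = uterm d.
Proof.
move=> [_ ->] x; rewrite in_fsetU => /orP[] /imfsetP[y yP ->].
  by left.
by right; exists y.
Qed.

Lemma adjacent_sym H : symmetric (adjacent H).
Proof. by move=> x y; apply: eq_has => d; rewrite orbC. Qed.

(** The vertices whose path extends that of x form the part of the tree beyond
    the edge ending at x.  A path in F from the root to x enters this part, and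
    the edge ending at x is the only way in. *)
Lemma quota_forest_grounded F : quota_forest F -> grounded F.
Proof.
move=> [subF treeF]; split=> //; apply/fsetP => x; rewrite in_fsetU.
apply/idP/orP; last first.
  case=> /imfsetP[y /= yP ->]; last by case: (subF _ yP).
  by have [+ _] := treeF y; rewrite !inE => /andP[].
move=> xF; have [/walk_eq0-> | /eqP xnr] := eqVneq (walk x) [::].
  by left; apply: mem_uroots.
right; have [rootx connx] := treeF (tag x).
have [|p [pth lastx]] := connx (uroot G (tag x)) x rootx.
  by rewrite !inE xF /=.
pose below y := (tag x == tag y) && prefix (walk x) (walk y).
have [||y [z [/hasP[d dF yz] yx zx]]] := path_crossing pth (D := below).
- by rewrite /below eqxx andTb walk_uroot prefixs0; apply/eqP.
- by rewrite lastx /below eqxx prefix_refl.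
move: dF; rewrite /= !inE => /andP[dF _].
have step : below (uterm d) -> ~~ below (uinit d) -> x = uterm d.
  rewrite /below => /andP[/eqP tagx]; rewrite tagx /= eqxx walk_uterm /=.
  rewrite prefixE => /eqP takex; rewrite prefixE => /eqP ntake.
  apply: walk_inj => //; rewrite walk_uterm -takex.
  rewrite take_oversize // size_rcons ltnNge; apply/negP => sz.
  by apply: ntake; rewrite -{2}takex -cats1 takel_cat.
have stepr : below (uinit d) -> below (uterm d).
  rewrite /below => /andP[->]; rewrite walk_uterm => /prefix_trans-> //.
  exact: prefix_rcons.
case/orP: yz => /andP[/eqP ey /eqP ez].
  by rewrite step ?ey ?ez //; apply/imfsetP; exists d.
by case/negP: yx; rewrite -ez stepr // ey.
Qed.

(** Following back the edge that ends at it, each vertex reaches the root of its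
    copy, so any two vertices of a copy are joined through that root. *)
Lemma grounded_quota_forest F : grounded F -> quota_forest F.
Proof.
move=> grF; have [subF eF] := grF; split=> // c.
have rootF : uroot G c \in (in_copy F c).1.
  by rewrite !inE /= eqxx andbT eF in_fsetU mem_uroots.
split=> //.
have fromroot x : x \in (in_copy F c).1 ->
    exists p, path (adjacent (in_copy F c)) (uroot G c) p
              /\ last (uroot G c) p = x.
  have [k] := ubnP (size (walk x)); elim: k x => // k IHk x ltk.
  rewrite !inE => /andP[xF /eqP tagx].
  have [xr|[d dF xd]] := groundedP grF xF.
    by exists [::]; rewrite xr tagx.
  have tagd : tag (uinit d) = c by rewrite -tagx xd.
  have [||p [pth lastp]] := IHk (uinit d).
  - by move: ltk; rewrite xd walk_uterm size_rcons ltnS.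
  - by rewrite !inE tagd eqxx andbT; case: (subF d dF).
  exists (rcons p x); rewrite last_rcons rcons_path pth lastp; split=> //=.
  by apply/hasP; exists d; rewrite ?inE /= ?dF ?tagd ?eqxx // xd eqxx.
move=> x y /fromroot[p [pthp lastp]] /fromroot[r [pthr lastr]].
exists (rev (belast (uroot G c) p) ++ r); rewrite cat_path last_cat.
have -> : last x (rev (belast (uroot G c) p)) = uroot G c.
  by move: lastp; case: p {pthp} => [|z p] //=; rewrite rev_cons last_rcons.
rewrite pthr lastr andbT; split; last by [].
by move: (path_rev_sym (@adjacent_sym _) pthp); rewrite lastp.
Qed.

Lemma stage_invariant used seen : search_stage used seen ->
  [/\ grounded used, used.2 `<=` seen.2
    & forall d, d \in seen.2 -> uinit d \in used.1].
Proof.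
elim=> {used seen} [|used seen d _ [[subU eU] le_us init] [dU dS]
                   |used seen d _ [grU le_us init] [dU dS]].
- by do 2?split=> //; rewrite imfset0 fsetU0.
- split=> [||d'].
  + split=> [d'|]; last by rewrite /= imfsetU1 eU fsetUCA.
    rewrite in_fset1U => /predU1P[->|/subU[initU termU]].
      by split; apply/fset1UP; [right | left].
    by split; apply/fset1UP; right.
  + exact: fsetUS.
  + by rewrite in_fset1U => /predU1P[->|/init initU]; apply/fset1UP; right.
- split=> // [|d']; first exact: fsubset_trans (fsubsetU1 _ _).
  by rewrite in_fset1U => /predU1P[->|/init].
Qed.

Definition lifts (X : {fset uvertex G s}) w := [fset x in X | uproj x == w].

Definition edges_over (E : {fset uedge G s}) v :=
  [fset d in E | uproj (uterm d) == v].

Lemma edge_countE F v : edge_count F 0 v = #|` edges_over F.2 v|.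
Proof. by rewrite mxE. Qed.

Lemma card_copies w : #|[pred c : copy s | tag c == w]| = s 0 w.
Proof.
pose f (k : 'I_(s 0 w)) : copy s := Tagged (fun v => 'I_(s 0 v)) k.
rewrite -[RHS]card_ord -(card_image (f := f)); last first.
  by move=> k k' /eqP; rewrite eq_Tagged => /eqP.
apply: eq_card => -[v k]; rewrite inE /=; apply/eqP/imageP => [vw|[k' _]].
  by case: w / vw @f => f; exists k.
by move=> /(congr1 tag).
Qed.

(** Every vertex of a grounded forest is either one of the s_w roots above w or
    the end of exactly one edge. *)
Lemma card_lifts_grounded F w : grounded F ->
  #|` lifts F.1 w| = (s 0%R w + edge_count F 0%R w)%N.
Proof.
move=> [_ eF]; have {eF} -> : lifts F.1 w =
    [fset uroot G c | c in [pred c : copy s | tag c == w]]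
    `|` (@uterm n G s @` edges_over F.2 w).
  rewrite eF; apply/fsetP => x; rewrite !inE; apply/andP/orP => [[]|[]].
  - case/orP=> /imfsetP[y /= yF ->] /eqP yw; [left|right].
      by apply/imfsetP; exists y; rewrite ?inE //=; apply/eqP.
    by apply/imfsetP; exists y; rewrite ?inE //= yF; apply/eqP.
  - case/imfsetP=> c /= /eqP <- ->.
    by rewrite mem_uroots.
  - case/imfsetP=> d; rewrite !inE => /andP[dF dw] ->; rewrite dw; split=> //.
    by rewrite in_imfset ?orbT.
rewrite edge_countE.
have := cardfsUI [fset uroot G c | c in [pred c : copy s | tag c == w]]
                 (@uterm n G s @` edges_over F.2 w).
rewrite (_ : _ `&` _ = fset0) ?cardfs0 ?addn0 => [->|].
  rewrite card_imfset; last exact: uroot_inj.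
  rewrite card_imfset; last exact: uterm_inj.
  by rewrite /= -cardE card_copies.
apply/fsetP => x; rewrite !inE; apply/andP => -[/imfsetP[c _ ->] /imfsetP[d _]].
exact: uroot_neq_uterm.
Qed.

(** U may be infinite, so the set of edges leaving X is listed from the pairs
    (x, e) rather than cut out of the type of all edges. *)
Definition out_edges (X : {fset uvertex G s}) v : {fset uedge G s} :=
  seq_fset tt (pmap insub
    [seq (x, e) | x <- X,
      e <- enum [set e | (src e == uproj x) && (tgt e == v)]]).

Lemma mem_out_edges X v d :
  (d \in out_edges X v) = (uinit d \in X) && (uproj (uterm d) == v).
Proof.
rewrite seq_fsetE mem_pmap_sub uproj_uterm /uinit.
apply/allpairsPdep/andP => [[x [e [xX]]]|[dX dv]].
  by rewrite mem_enum inE => /andP[_ ev] -> /=.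
exists (val d).1, (val d).2.
by rewrite mem_enum inE dv (valP d) -surjective_pairing.
Qed.

Lemma card_out_edges X v :
  #|` out_edges X v| = (\sum_w #|` lifts X w| * adjmx G w v)%N.
Proof.
rewrite size_seq_fset undup_id; last first.
  apply/pmap_sub_uniq/allpairs_uniq_dep => [|x _|]; first exact: fset_uniq.
    exact: enum_uniq.
  by move=> [x e] [x' e'] _ _ /= [-> ->].
rewrite size_pmap_sub.
transitivity (\sum_(x <- X) adjmx G (uproj x) v)%N; last first.
  rewrite (partition_big (@uproj n G s) predT) //=; apply: eq_bigr => w _.
  rewrite (eq_bigr (fun=> adjmx G w v)) => [|x /eqP-> //].
  rewrite big_const_seq iter_addn_0 mulnC; congr (_ * _)%N.
  by rewrite card_imfset //= size_filter.
set st := [seq _ | x <- _, e <- _].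
transitivity (size st).
  apply/eqP; rewrite -all_count; apply/allP => _ /allpairsPdep[x [e [_ eE ->]]].
  by move: eE; rewrite mem_enum inE => /andP[].
rewrite size_allpairs_dep sumnE big_map; apply: eq_bigr => x _.
by rewrite -cardE mxE.
Qed.

End Cover.

(** * Counting the completions of a search stage *)

Section Search.
Variables (n : nat) (G : multidigraph n) (s q : 'rV[nat]_n).
Implicit Types (F used seen : usub G s) (d : uedge G s) (v : 'I_n).

Definition completion used seen F : Prop :=
  [/\ quota_forest F, achieves F q, extends used F
    & forall d, d \in seen.2 `\` used.2 -> d \notin F.2].

Definition supply seen : 'rV[int]_n :=
  map_mx Posz (q *m adjmx G) - map_mx Posz (edge_count seen).

Definition demand used : 'rV[int]_n :=
  map_mx Posz q - map_mx Posz s - map_mx Posz (edge_count used).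

Lemma demandE used v : grounded used ->
  demand used 0 v = (q 0 v)%:Z - (#|` lifts used.1 v|)%:Z.
Proof. by move=> /card_lifts_grounded->; rewrite !mxE PoszD opprD addrA. Qed.

Lemma card_out_edges_achieves F v :
  achieves F q -> #|` out_edges F.1 v| = (q *m adjmx G) 0 v.
Proof.
move=> achF; rewrite card_out_edges mxE; apply: eq_bigr => w _.
by rewrite -achF.
Qed.

(** In a completion F, demand counts the edges of F above v that are not yet
    used, and supply counts the edges leaving F above v that are not yet seen;
    a seen edge lies in F only if it is used, so the former are among the
    latter. *)
Lemma completion_bounds used seen F : search_stage used seen ->
  completion used seen F -> forall v, 0 <= demand used 0 v <= supply seen 0 v.
Proof.
move=> /stage_invariant[grU le_us init] [qfF achF [le1 le2] skip] v.
have grF := quota_forest_grounded qfF; have [subF _] := grF.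
have qE : q 0 v = (s 0%R v + edge_count F 0%R v)%N.
  by rewrite -card_lifts_grounded // -achF.
have UF : edges_over used.2 v `<=` edges_over F.2 v.
  apply/fsubsetP => d; rewrite !inE => /andP[dU ->].
  by rewrite (fsubsetP le2).
have := cardfsUI (edges_over F.2 v) (edges_over seen.2 v).
have -> : edges_over F.2 v `&` edges_over seen.2 v = edges_over used.2 v.
  apply/fsetP => d; rewrite !inE; case: (_ == v); rewrite ?andbF // !andbT.
  apply/andP/idP => [[dF dS]|dU]; last first.
    by rewrite (fsubsetP le2) // (fsubsetP le_us).
  by apply: contraTT dF => dU; apply: skip; rewrite in_fsetD dU.
have out : edges_over F.2 v `|` edges_over seen.2 v `<=` out_edges F.1 v.
  apply/fsubsetP => d; rewrite mem_out_edges !inE.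
  case/orP=> /andP[dd ->]; rewrite andbT; first by case: (subF d dd).
  by apply: (fsubsetP le1); apply: init.
have := fsubset_leq_card out; rewrite card_out_edges_achieves //.
have := fsubset_leq_card UF.
rewrite -!edge_countE !mxE -!edge_countE qE => h1 h2 h3.
apply/andP; split; lia.
Qed.

(** By [demandE], q - demand counts the used vertices, and the edges that leave
    those are either seen or in the queue. *)
Lemma supplyE used seen v : search_stage used seen ->
  supply seen 0 v = (demand used *m map_mx Posz (adjmx G)) 0 v
                    + (#|` out_edges used.1 v `\` seen.2|)%:Z.
Proof.
move=> /stage_invariant[grU _ init].
have -> : (#|` out_edges used.1 v `\` seen.2|)%:Z =
    (#|` out_edges used.1 v|)%:Z - (edge_count seen 0 v)%:Z.
  rewrite edge_countE cardfsD.
  have -> : out_edges used.1 v `&` seen.2 = edges_over seen.2 v.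
    apply/fsetP => d; rewrite in_fsetI mem_out_edges !inE andbC.
    by apply: andb_id2l => /init->.
  rewrite subzn //; apply: fsubset_leq_card; apply/fsubsetP => d.
  by rewrite mem_out_edges !inE => /andP[/init-> ->].
rewrite addrA [in LHS]mxE [X in _ + X]mxE [in X in _ + X]mxE; congr (_ - _).
rewrite card_out_edges !mxE -!natz !natr_sum -big_split.
apply: eq_bigr => w _; rewrite demandE // [map_mx _ _ _ _]mxE -!natz !natrM.
by rewrite /= mulrBl subrK.
Qed.

Lemma in_edges_over (E : {fset uedge G s}) v d :
  (d \in edges_over E v) = (d \in E) && (uproj (uterm d) == v).
Proof. by rewrite !inE. Qed.

Lemma edge_count_add F d : d \notin F.2 ->
  map_mx Posz (edge_count (add_edge F d))
  = map_mx Posz (edge_count F) + delta_mx 0 (uproj (uterm d)).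
Proof.
move=> dF; apply/rowP => v.
rewrite [LHS]mxE [RHS]mxE [X in X + _]mxE !edge_countE.
rewrite [delta_mx _ _ _ _]mxE eqxx andTb.
have [dv|dv] := eqVneq v (uproj (uterm d)).
  have -> : edges_over (add_edge F d).2 v = d |` edges_over F.2 v.
    apply/fsetP => d'; rewrite in_edges_over !in_fset1U in_edges_over.
    have [->|_] := eqVneq d' d; last by rewrite !orFb.
    by rewrite -dv eqxx.
  by rewrite cardfsU1 in_edges_over (negPf dF) andFb PoszD addrC.
have -> : edges_over (add_edge F d).2 v = edges_over F.2 v.
  apply/fsetP => d'; rewrite !in_edges_over in_fset1U.
  have [->|_] := eqVneq d' d; last by rewrite orFb.
  by rewrite [_ == v]eq_sym (negPf dv) !andbF.
by rewrite addr0.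
Qed.

Lemma completion_queued used seen d F : search_stage used seen ->
    queued used seen d ->
  completion used seen F <->
  completion (add_edge used d) (add_edge seen d) F \/
  completion used (add_edge seen d) F.
Proof.
move=> /stage_invariant[_ le_us _] [dU dS]; split.
  move=> [qfF achF [le1 le2] skip]; have [subF _] := qfF.
  have [dF|dF] := boolP (d \in F.2); [left|right]; split=> //.
  - split; rewrite fsubUset fsub1set ?dF ?le1 ?le2 ?andbT //.
    by case: (subF d dF).
  - move=> d'; rewrite in_fsetD !in_fset1U negb_or => /andP[/andP[dd' d'U]].
    by rewrite (negPf dd') => d'S; apply: skip; rewrite in_fsetD d'U.
  - move=> d'; rewrite in_fsetD in_fset1U => /andP[d'U /predU1P[-> //|d'S]].
    by apply: skip; rewrite in_fsetD d'U.
case=> -[qfF achF ext skip]; split=> //.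
- by case: ext; rewrite !fsubUset => /andP[_ ?] /andP[_ ?].
- move=> d'; rewrite in_fsetD => /andP[d'U d'S]; apply: skip.
  rewrite in_fsetD !in_fset1U negb_or d'U d'S orbT !andbT.
  by apply: contraNneq dS => <-.
- move=> d'; rewrite in_fsetD => /andP[d'U d'S]; apply: skip.
  by rewrite in_fsetD in_fset1U d'U d'S orbT.
Qed.

Lemma completion_disjoint used seen d F : search_stage used seen ->
    queued used seen d ->
  completion (add_edge used d) (add_edge seen d) F ->
  ~ completion used (add_edge seen d) F.
Proof.
move=> /stage_invariant[_ le_us _] [dU dS] [_ _ [_ le2] _] [_ _ _ skip].
have /negP[] : d \notin F.2.
  apply: skip; rewrite in_fsetD fset1U1 andbT.
  by apply: contra dS; apply: (fsubsetP le_us).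
by apply: (fsubsetP le2); apply: fset1U1.
Qed.

(** With an empty queue, a completion has no way out of the used forest: by
    induction on depth, each of its edges starts at a used vertex, so it is
    seen, so it is used.  Hence it is the used forest. *)
Lemma completion_closed used seen F : search_stage used seen ->
    (forall d, uinit d \in used.1 -> d \in seen.2) ->
  completion used seen F <-> F = used /\ demand used = 0.
Proof.
move=> /stage_invariant[grU le_us _] closed; split; last first.
  move=> [-> dem0]; split.
  - exact: grounded_quota_forest.
  - move=> w; move: dem0 => /rowP/(_ w); rewrite demandE // mxE.
    by rewrite -/(lifts used.1 w); lia.
  - by split; apply: fsubset_refl.
  - by move=> d; rewrite in_fsetD => /andP[].
move=> [qfF achF [le1 le2] skip]; have grF := quota_forest_grounded qfF.
have FU d : d \in F.2 -> d \in used.2.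
  have [k] := ubnP (size (walk (uinit d))); elim: k d => // k IHk d ltk dF.
  suff dU : uinit d \in used.1.
    apply: contraLR dF => ndU; apply: skip.
    by rewrite in_fsetD ndU closed.
  have [subF _] := grF; have [initF _] := subF d dF.
  have [subU eU] := grU.
  case: (groundedP grF initF) => [->|[d' d'F e]].
    by rewrite eU in_fsetU mem_uroots.
  rewrite e; have [] // := subU d'; apply: IHk => //.
  by move: ltk; rewrite e walk_uterm size_rcons ltnS.
have eF2 : F.2 = used.2.
  by apply/eqP; rewrite eqEfsubset le2 andbT; apply/fsubsetP.
have eF : F = used.
  move: grF grU eF2 => [_ +] [_ +].
  by case: (F) => [F1 F2]; case: (used) => [U1 U2] /= -> -> ->.
split=> //; apply/rowP => v; rewrite demandE // [RHS]mxE -eF -achF.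
by rewrite subrr.
Qed.

(** Each step of the search lowers the total supply by 1, and the supply
    is nonnegative as long as the demand lies between 0 and the supply, which
    bounds the recursion. *)
Lemma card_completions used seen : search_stage used seen ->
  exists L : {fset usub G s},
    (forall F, F \in L <-> completion used seen F) /\
    (#|` L|)%:R = quota_symbol (adjmx G) (supply seen) (demand used).
Proof.
pose left_over seen := (\sum_v `|supply seen 0%R v|)%N.
have [k] := ubnP (left_over seen).
elim: k used seen => // k IHk used seen ltk stage.
have [/forallP rng|/forallPn[v out]] :=
    boolP [forall v, 0 <= demand used 0 v <= supply seen 0 v]; last first.
  exists fset0; rewrite cardfs0 (quota_symbol_out _ out); split=> // F.
  by split=> // /(completion_bounds stage)/(_ v); rewrite (negPf out).
have [/forallP empty|/forallPn[v]] :=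
    boolP [forall v, out_edges used.1 v `\` seen.2 == fset0].
  have closed d : uinit d \in used.1 -> d \in seen.2.
    move=> dU; have /eqP/fsetP/(_ d) := empty (uproj (uterm d)).
    by rewrite in_fsetD mem_out_edges dU eqxx !andbT in_fset0 => /negbT/negPn.
  rewrite quota_symbol_closed; last first.
    by apply/rowP => v; rewrite (supplyE v stage) (eqP (empty v)) cardfs0 addr0.
  exists (if demand used == 0 then [fset used] else fset0); split.
    move=> F; rewrite (completion_closed F stage closed).
    case: eqVneq => [->|/eqP dn0]; last by split=> // -[].
    by rewrite in_fset1; split=> [/eqP|[->]].
  by case: eqP; rewrite ?cardfs1 ?cardfs0.
case/fset0Pn=> d; rewrite in_fsetD mem_out_edges => /and3P[dS dU /eqP dv].
have qd : queued used seen d by [].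
have dnU : d \notin used.2.
  have [_ le_us _] := stage_invariant stage.
  by apply: contra dS; apply: (fsubsetP le_us).
have supplyd : supply (add_edge seen d) = supply seen - delta_mx 0 v.
  by rewrite /supply edge_count_add // dv opprD addrA.
have demandd : demand (add_edge used d) = demand used - delta_mx 0 v.
  by rewrite /demand edge_count_add // dv opprD addrA.
have queue_gt0 : 0 < (#|` out_edges used.1 v `\` seen.2|)%:Z.
  rewrite ltz_nat cardfs_gt0; apply/fset0Pn; exists d.
  by rewrite in_fsetD dS mem_out_edges dU dv eqxx.
have term_ge0 w : 0 <= demand used 0 w * (adjmx G w v)%:Z.
  by apply: mulr_ge0 => //; case/andP: (rng w).
have supvE : supply seen 0 v = \sum_w demand used 0 w * (adjmx G w v)%:Z
    + (#|` out_edges used.1 v `\` seen.2|)%:Z.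
  rewrite (supplyE v stage) mxE; congr (_ + _); apply: eq_bigr => w _.
  by rewrite [map_mx _ _ _ _]mxE.
have sum_ge0 : 0 <= \sum_w demand used 0 w * (adjmx G w v)%:Z.
  exact: sumr_ge0.
have supv : 0 < supply seen 0 v by rewrite supvE; lia.
have lt_left : (left_over (add_edge seen d) < k)%N.
  move: ltk; rewrite ltnS; apply: leq_trans; rewrite /left_over supplyd.
  rewrite (bigD1 v) //= [X in (_ < X)%N](bigD1 v) //= -addSn leq_add //.
    by rewrite row_sub_delta eqxx; lia.
  apply: leq_sum => w /negPf wv.
  by rewrite row_sub_delta wv subr0.
have [L1 [L1P card1]] := IHk _ _ lt_left (stage_use stage qd).
have [L2 [L2P card2]] := IHk _ _ lt_left (stage_skip stage qd).
exists (L1 `|` L2); split.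
  move=> F; rewrite in_fsetU (completion_queued F stage qd) -L1P -L2P.
  by split=> /orP.
have := cardfsUI L1 L2; rewrite (_ : L1 `&` L2 = fset0); last first.
  apply/fsetP => F; rewrite in_fsetI in_fset0; apply/andP => -[/L1P F1 /L2P].
  exact: completion_disjoint F1.
rewrite cardfs0 addn0 => ->; rewrite natrD card1 card2 supplyd demandd addrC.
apply/esym/quota_symbol_pascal => [|supv1 demv1 w]; first by rewrite gt_eqF.
(* The queued edge d already accounts for the whole supply 1 at v. *)
have sum0 : \sum_w demand used 0 w * (adjmx G w v)%:Z = 0 by lia.
exact: (psumr_eq0P (fun w _ => term_ge0 w) sum0).
Qed.

End Search.

Theorem theorem13 (n : nat) (G : multidigraph n) (q s : 'rV[nat]_n)
    (used seen : usub G s) (hstage : search_stage used seen) :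
  exists L : {fset usub G s},
    (forall F : usub G s,
       F \in L <->
       [/\ quota_forest F, achieves F q, extends used F
         & forall d, d \in seen.2 `\` used.2 -> d \notin F.2]) /\
    (#|` L|)%:R =
      quota_symbol (adjmx G)
        (map_mx Posz (q *m adjmx G) - map_mx Posz (edge_count seen))
        (map_mx Posz q - map_mx Posz s - map_mx Posz (edge_count used)).
Proof. exact: card_completions. Qed.
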